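(* For every finite graph $G$, \[ \left\lfloor \frac{\mathrm{adm}_{\infty}(G)+1}{2}\right\rfloor \leq \beta(G)\leq \mathrm{adm}_{\infty}(G). \]
   Context: For $k \in \mathbb{N}$, a set $X$ of at least $k$ vertices of $G$ is $(<\!k)$-inseparable if no two vertices of $X$ can be separated in $G$ by deleting fewer than $k$ vertices; a $k$-block is a maximal such set, and $\beta(G)$ is the maximum $k$ for which $G$ contains a $k$-block. A $k$-fan from a vertex $v$ is a collection of $k$ paths all starting at $v$ and otherwise pairwise disjoint; the trivial path consisting only of $v$ (with end-vertex $v$) is allowed. It is a $k$-fan to $U\subseteq V(G)$ if every path in it ends in $U$. A set $X\subseteq V(G)$ is a $k$-fan-set if from every $x\in X$ there is a $k$-fan to $X$. The $\infty$-admissibility $\mathrm{adm}_\infty(G)$ is the maximum $k$ for which $G$ contains a $k$-fan-set. *)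

(* Defs.v *)
From mathcomp Require Import all_boot.

Set Implicit Arguments.
Unset Strict Implicit.
Unset Printing Implicit Defensive.

(* A finite simple graph on the vertex type T is given by its adjacency
   relation e, assumed symmetric and irreflexive where it matters. *)
Section Graph.

Variables (T : finType) (e : rel T).

Definition delete (S : {set T}) : rel T :=
  [rel a b | [&& e a b, a \notin S & b \notin S]].

Definition separates (S : {set T}) (x y : T) : bool :=
  [&& x \notin S, y \notin S & ~~ connect (delete S) x y].

Definition inseparable (k : nat) (X : {set T}) : bool :=
  (k <= #|X|) &&
  [forall x in X, forall y in X, forall S : {set T},
     (x != y) && (#|S| < k) ==> ~~ separates S x y].

Definition block (k : nat) (X : {set T}) : bool := maxset (inseparable k) X.

(* No k > #|T| contributes: see leq_beta and beta_attained. *)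
Definition beta : nat :=
  \max_(k < #|T|.+1 | [exists X : {set T}, block k X]) k.

(* A path with first vertex v is encoded by the sequence p of its remaining
   vertices, so p = [::] is the trivial path.  Since its vertices are distinct,
   p has fewer than #|T| entries: working with bounded sequences excludes no
   path, and makes the collections of paths range over a finite type. *)
Definition path_from (v : T) (p : seq T) : bool := path e v p && uniq (v :: p).

(* The paths of a fan share v and nothing else; as v occurs in no p, this is
   disjointness of the sequences p.  A fan is a set of paths, so the trivial
   path is used at most once. *)
Definition fan (k : nat) (v : T) (P : {set #|T|.-bseq T}) : bool :=
  [&& #|P| == k,
      [forall p in P, path_from v p]
    & [forall p in P, forall q in P,
         (p != q) ==> [disjoint (p : seq T) & (q : seq T)]]].

Definition fan_to (k : nat) (v : T) (U : {set T}) (P : {set #|T|.-bseq T})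
  : bool :=
  fan k v P && [forall p in P, last v (p : seq T) \in U].

Definition fan_set (k : nat) (X : {set T}) : bool :=
  [forall x in X, exists P : {set #|T|.-bseq T}, fan_to k x X P].

(* The empty set is vacuously a k-fan-set for every k and has to be left out
   for the maximum to exist; on the graph with no vertices the value is 0.
   No k > #|T| contributes: see leq_adm and adm_attained. *)
Definition adm_infty : nat :=
  \max_(k < #|T|.+1 | [exists X : {set T}, (X != set0) && fan_set k X]) k.

Lemma leq_beta k X : block k X -> k <= beta.
Proof.
move=> bX.
have kT : k < #|T|.+1.
  by case/maxsetP: bX => /andP[kX _] _; exact: leq_trans kX (max_card _).
have H : [exists X : {set T}, block (Ordinal kT) X] by apply/existsP; exists X.
exact: (@leq_bigmax_cond _ _ (fun i : 'I__ => i : nat) _ H).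
Qed.

Lemma block0 : block 0 [set: T].
Proof.
apply/maxsetP; split=> [|B _]; last by rewrite subTset => /eqP.
apply/andP; split=> //; apply/forall_inP => x _; apply/forall_inP => y _.
by apply/forallP => S; rewrite andbF.
Qed.

Lemma beta_attained : exists X, block beta X.
Proof.
apply/existsP.
have H0 : 0 < #|[pred k : 'I_#|T|.+1 | [exists X : {set T}, block k X]]|.
  by apply/card_gt0P; exists ord0; apply/existsP; exists setT; exact: block0.
rewrite /beta.
by case: (eq_bigmax_cond (fun k : 'I_#|T|.+1 => k : nat) H0) => k kP ->.
Qed.

Lemma leq_fan k v P : fan k v P -> k <= #|T|.
Proof.
case/and3P=> /eqP <- /forall_inP pP /forall_inP dP.
pose f (p : #|T|.-bseq T) := last v p.
rewrite -(@card_in_imset _ _ f) ?max_card // => p q Pp Pq; rewrite /f => eqf.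
apply/eqP; apply: contraT => npq.
have /implyP/(_ npq) := forall_inP (dP _ Pp) _ Pq.
have /andP[_ /andP[vp _]] := pP _ Pp; have /andP[_ /andP[vq _]] := pP _ Pq.
move: eqf vp vq npq; rewrite -val_eqE /=.
case: (val p) (val q) => [|a s] [|b t] //=.
- by move=> eqv _; rewrite {1}eqv mem_last.
- by move=> eqv; rewrite -{1}eqv mem_last.
move=> eqf _ _ _; rewrite disjoint_has => /hasPn/(_ (last a s)).
by rewrite mem_last eqf /= mem_last => /(_ isT).
Qed.

Lemma leq_adm k X : X != set0 -> fan_set k X -> k <= adm_infty.
Proof.
move=> X0 fX; have kT : k < #|T|.+1.
  case/set0Pn: X0 => x /(forall_inP fX)/existsP[P /andP[fP _]].
  exact: leq_fan fP.
have H : [exists X : {set T}, (X != set0) && fan_set (Ordinal kT) X].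
  by apply/existsP; exists X; rewrite X0.
exact: (@leq_bigmax_cond _ _ (fun i : 'I__ => i : nat) _ H).
Qed.

Lemma adm_attained : 0 < #|T| -> exists2 X, X != set0 & fan_set adm_infty X.
Proof.
case/card_gt0P=> x0 _.
suff /existsP[X /andP[]] :
  [exists X : {set T}, (X != set0) && fan_set adm_infty X] by exists X.
have H0 : 0 < #|[pred k : 'I_#|T|.+1 |
    [exists X : {set T}, (X != set0) && fan_set k X]]|.
  apply/card_gt0P; exists ord0; apply/existsP; exists setT.
  apply/andP; split; first by apply/set0Pn; exists x0.
  apply/forall_inP => x _; apply/existsP; exists set0.
  apply/andP; split; last by apply/forall_inP => p; rewrite inE.
  by apply/and3P; split; rewrite ?cards0 //; apply/forall_inP => p; rewrite inE.
rewrite /adm_infty.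
by case: (eq_bigmax_cond (fun k : 'I_#|T|.+1 => k : nat) H0) => k kP ->.
Qed.

End Graph.

(* Main.v *)
From HB Require Import structures.
Require Import Defs.
From mathcomp Require Import all_boot.

Set Implicit Arguments.
Unset Strict Implicit.
Unset Printing Implicit Defensive.

(* Upper bound: by Menger's theorem a (<k)-inseparable set of at least k
   vertices is a k-fan-set.

   Lower bound: let X be a nonempty (2k-1)-fan-set, and take a tree-decomposition
   of adhesion < k minimizing the sum of 3^|V| over its bags V with |V| >= k.
   Let p be a leaf-most side, cut off at a bag W, such that X is not contained
   in p; then Y = X \ p lies in W, and each vertex of Y has a (2k-1)-fan to W.
   At most k-1 of its paths end up in p, so |Y| >= k.  If fewer than k vertices
   S separated two vertices of Y, at least k paths of the fan of either would
   avoid S, giving a separation (C, D) of order < k with |W /\ C|, |W /\ D| >= k.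
   As in the proof of Bellenbaum and Diestel that lean tree-decompositions
   exist, choosing (C, D) with C /\ D as close to W as possible and splitting
   every bag along it lowers the potential, a contradiction. *)

(** * Menger's theorem *)

Section Connect.

Variable T : finType.

(** [connect_sub] asks for the inclusion at all vertices; the proof of Menger's theorem knows it
    only along arcs at vertices reachable from the start. *)
Lemma connect_sub_from (r r' : rel T) a z :
  (forall u w, connect r a u -> r u w -> r' u w) ->
  connect r a z -> connect r' a z.
Proof.
move=> sub /connectP[p]; elim/last_ind: p z => [|p w IHp] z /=.
  by move=> _ ->.
rewrite rcons_path last_rcons => /andP[pp rw] ->.
have cu: connect r a (last a p) by apply/connectP; exists p.
by apply: connect_trans (IHp _ pp erefl) (connect1 (sub _ _ cu rw)).
Qed.

Lemma connect_sub_to (r r' : rel T) a z :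
  (forall u w, connect r w z -> r u w -> r' u w) ->
  connect r a z -> connect r' a z.
Proof.
move=> sub /connectP[p]; elim: p a => [|w p IHp] a /=.
  by move=> _ ->.
move=> /andP[rw pp] Ez.
have cw: connect r w z by apply/connectP; exists p.
by apply: connect_trans (connect1 (sub _ _ cw rw)) (IHp _ pp Ez).
Qed.

Lemma deleteE (e : rel T) (S : {set T}) a b :
  delete e S a b = [&& e a b, a \notin S & b \notin S].
Proof. by []. Qed.

Lemma path_delete (e : rel T) (S : {set T}) a s :
  path e a s -> {in a :: s, forall z, z \notin S} -> path (delete e S) a s.
Proof.
elim: s a => //= b s IHs a /andP[eab ps] aS.
rewrite deleteE eab aS ?mem_head // aS ?inE ?eqxx ?orbT //=.
by apply: IHs => // z zs; apply: aS; rewrite inE zs orbT.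
Qed.

Lemma shorten_path (e : rel T) a s : path e a s ->
  exists s', [/\ path e a s', uniq (a :: s'), last a s' = last a s
    & {subset s' <= s}].
Proof. by case/shortenP=> s' ps' us' sub; exists s'; split=> // z /sub. Qed.

End Connect.

Section Menger.

Variable T : finType.
Implicit Types (e : rel T) (A B S : {set T}).

(** [S] may meet [A] and [B]. As [connect] is reflexive, it has to contain [A :&: B]. *)
Definition separator e A B S : Prop :=
  forall a b, a \in A -> b \in B -> a \notin S -> b \notin S ->
  ~~ connect (delete e S) a b.

Definition arcs e : {set T * T} := [set u | e u.1 u.2].

Definition path_between e A B (u : T * seq T) : Prop :=
  [/\ u.1 \in A, path e u.1 u.2, uniq (u.1 :: u.2) & last u.1 u.2 \in B].

Definition vertices (u : T * seq T) : seq T := u.1 :: u.2.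

Definition linked e A B k : Prop :=
  exists2 f : 'I_k -> T * seq T, forall i, path_between e A B (f i)
    & forall i j z, z \in vertices (f i) -> z \in vertices (f j) -> i = j.

Lemma mem_last_vertices u : last u.1 u.2 \in vertices u.
Proof. exact: mem_last. Qed.

Lemma linked_onto_last k (f : 'I_k -> T * seq T) B :
  #|B| = k -> (forall i, last (f i).1 (f i).2 \in B) ->
  (forall i j z, z \in vertices (f i) -> z \in vertices (f j) -> i = j) ->
  forall b, b \in B -> exists i, last (f i).1 (f i).2 = b.
Proof.
move=> cB fB df b bB; pose l i := last (f i).1 (f i).2.
have injl : injective l.
  move=> i j lij; apply: (df i j (l i)); first exact: mem_last_vertices.
  by rewrite lij; exact: mem_last_vertices.
have /eqP El : l @: setT == B.
  rewrite eqEcard card_imset // cB cardsT card_ord leqnn andbT.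
  by apply/subsetP => _ /imsetP[i _ ->]; exact: fB.
by move: bB; rewrite -El => /imsetP[i _ ->]; exists i.
Qed.

Lemma linked_onto_head k (f : 'I_k -> T * seq T) A :
  #|A| = k -> (forall i, (f i).1 \in A) ->
  (forall i j z, z \in vertices (f i) -> z \in vertices (f j) -> i = j) ->
  forall a, a \in A -> exists i, (f i).1 = a.
Proof.
move=> cA fA df a aA.
have injl : injective (fun i => (f i).1).
  move=> i j Eij; apply: (df i j (f i).1); first exact: mem_head.
  by rewrite Eij; exact: mem_head.
have /eqP El : [set (f i).1 | i : 'I_k] == A.
  rewrite eqEcard card_imset // cA card_ord leqnn andbT.
  by apply/subsetP => _ /imsetP[i _ ->]; exact: fA.
by move: aA; rewrite -El => /imsetP[i _ ->]; exists i.
Qed.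

(* The path systems are glued along S, and by the arc x -> y; they meet in S
   only, as S separates A from B once that arc is deleted. *)
Lemma glue_linked e e' A B S x y k :
  subrel e' e -> e x y -> x \notin S -> y \notin S ->
  separator e' A B S -> #|x |: S| = k -> #|y |: S| = k ->
  linked e' A (x |: S) k -> linked e' (y |: S) B k -> linked e A B k.
Proof.
move=> sub exy xS yS sepS cP cQ [f fP df] [g gP dg].
have ontof := linked_onto_last cP (fun i => let: And4 _ _ _ h := fP i in h) df.
have ontog := linked_onto_head cQ (fun i => let: And4 h _ _ _ := gP i in h) dg.
(* [sg] matches the two gluing sets: it fixes [S] and sends [x] to [y]. *)
pose l i := last (f i).1 (f i).2; pose sg p := if p == x then y else p.
have lP i : l i \in x |: S by case: (fP i).
have lastf i z : z \in vertices (f i) -> z \in x |: S -> z = l i.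
  move=> zf /ontof[j Ej]; suff -> : i = j by [].
  by apply: df zf _; rewrite -Ej mem_last_vertices.
have headg i z : z \in vertices (g i) -> z \in y |: S -> z = (g i).1.
  move=> zg /ontog[j Ej]; suff -> : i = j by [].
  by apply: dg zg _; rewrite -Ej mem_head.
(* Otherwise [f i] up to [z] and [g j] from [z] on join [A] to [B] outside [S]: [f i] can meet [S]
   only in its last vertex, [g j] only in its first. *)
have meet i j z : z \in vertices (f i) -> z \in vertices (g j) -> z \in S.
  move=> zf zg; apply: contraT => zS.
  have [fA pf uf _] := fP i; have [_ pg ug gB] := gP j.
  have Sl w : w \in vertices (f i) -> w \in S -> w = l i.
    by move=> wf wS; apply: lastf => //; rewrite inE wS orbT.
  have Sh w : w \in vertices (g j) -> w \in S -> w = (g j).1.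
    by move=> wg wS; apply: headg => //; rewrite inE wS orbT.
  move: zf zg fA pf uf Sl pg ug gB Sh; rewrite /l /vertices.
  case: (f i) => a s /=; case: (g j) => b t /=.
  case/splitPl=> s1 s2 Es1 zt aA; rewrite cat_path => /andP[ps1 _] uf Sl.
  have : uniq ((a :: s1) ++ s2) by exact: uf.
  rewrite cat_uniq => /and3P[_ ds0 _].
  have ds w : w \in s2 -> w \notin a :: s1.
    by move=> ws; move: ds0; apply: contra => wa; apply/hasP; exists w.
  have as1 : {in a :: s1, forall w, w \notin S}.
    move=> w ws; move: zS; apply: contra => wS.
    have Ew : w = last a (s1 ++ s2).
      by apply: Sl wS; rewrite -cat_cons mem_cat ws.
    case: s2 ds Ew {Sl ds0 uf} => [|c s2] ds Ew.
      by move: wS; rewrite Ew cats0 Es1.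
    by have := ds w; rewrite ws {1}Ew last_cat /= mem_last => /(_ isT).
  have c1 : connect (delete e' S) a z.
    by apply/connectP; exists s1 => //; exact: path_delete.
  case/splitPl: t / zt => t1 t2 Et1.
  rewrite cat_path Et1 last_cat Et1 => /andP[_ pt2] ug zB Sh.
  have : uniq ((b :: t1) ++ t2) by exact: ug.
  rewrite cat_uniq => /and3P[_ dt0 _].
  have dt w : w \in t2 -> w \notin b :: t1.
    by move=> wt; move: dt0; apply: contra => wb; apply/hasP; exists w.
  have zt2 : {in z :: t2, forall w, w \notin S}.
    move=> w; rewrite inE => /predU1P[-> //|wt].
    apply/negP => wS.
    have Ew : w = b by apply: Sh wS; rewrite -cat_cons mem_cat wt orbT.
    by have := dt w wt; rewrite Ew mem_head.
  have c2 : connect (delete e' S) z (last z t2).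
    by apply/connectP; exists t2 => //; exact: path_delete.
  have aS : a \notin S by apply: as1; rewrite mem_head.
  have bS : last z t2 \notin S by apply: zt2; rewrite mem_last.
  by have := sepS _ _ aA zB aS bS; rewrite (connect_trans c1 c2).
have sgQ i : sg (l i) \in y |: S.
  have := lP i; rewrite /sg !inE; case: eqP => [_|_] /=; rewrite ?eqxx //.
  by move=> ->; rewrite orbT.
have [J JP] : exists J : 'I_k -> 'I_k, forall i, (g (J i)).1 = sg (l i).
  by apply: (fin_all_exists (P := fun i j => (g j).1 = sg (l i))) => i; exact: ontog.
have injl i j : l i = l j -> i = j.
  move=> lij; apply: (df i j (l i)); first exact: mem_last_vertices.
  by rewrite lij; exact: mem_last_vertices.
have injsg p q : p \in x |: S -> q \in x |: S -> sg p = sg q -> p = q.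
  rewrite /sg !inE; case: eqP => [->|_]; case: eqP => [->|_] //=.
    by move=> _ qS yq; rewrite yq qS in yS.
  by move=> pS _ py; rewrite -py pS in yS.
have injJ i j : J i = J j -> i = j.
  move=> Jij; apply/injl/injsg => //.
  by rewrite -!JP Jij.
(* By [meet] the common vertex is in [S], so it ends [f i] and starts [g (J j)]; not being [y], it
   also ends [f j]. *)
have meet2 i j z : z \in vertices (f i) -> z \in vertices (g (J j)) -> i = j.
  move=> zf zg; have zS := meet _ _ _ zf zg.
  have zl : z = l i by apply: lastf => //; rewrite inE zS orbT.
  have : z = sg (l j) by rewrite -JP; apply: headg => //; rewrite inE zS orbT.
  rewrite /sg; case: eqP => [_ zy|_]; first by rewrite -zy zS in yS.
  by rewrite zl => /injl.
(* Concatenation may repeat vertices, hence the shortening; the arc from [x] to [y] is inserted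
   exactly when [f i] ends in [x]. *)
have H i : exists h, path_between e A B h /\
    forall z, z \in vertices h -> z \in vertices (f i) \/ z \in vertices (g (J i)).
  have [fA pf _ _] := fP i; have [_ pg _ gB] := gP (J i).
  move: (JP i) fA pf pg gB; rewrite /l /vertices.
  case: (f i) => a s /=; case: (g (J i)) => b t /= -> aA.
  move=> /(sub_path sub) ps /(sub_path sub) pt lB.
  rewrite /sg in pt lB *; case: eqP pt lB => [Ex|_] pt lB.
    have pst : path e a (s ++ y :: t) by rewrite cat_path ps /= Ex exy.
    have [s' [ps' us' ls' sub']] := shorten_path pst.
    exists (a, s'); split=> [|z]; first by split; rewrite //= ls' last_cat.
    rewrite !inE => /predU1P[->|/sub']; first by rewrite eqxx; left.
    by rewrite mem_cat => /orP[->|]; [rewrite orbT; left | rewrite inE; right].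
  have pst : path e a (s ++ t) by rewrite cat_path ps.
  have [s' [ps' us' ls' sub']] := shorten_path pst.
  exists (a, s'); split=> [|z]; first by split; rewrite //= ls' last_cat.
  rewrite !inE => /predU1P[->|/sub']; first by rewrite eqxx; left.
  by rewrite mem_cat => /orP[->|->]; rewrite orbT; [left|right].
have [h hP] := fin_all_exists H.
exists h => [i|i j z zi zj]; first by case: (hP i).
case: (hP i) (hP j) => _ /(_ z zi) zi' [_ /(_ z zj) zj'].
case: zi' zj' => zi' [] zj'.
- exact: df zi' zj'.
- exact: meet2 zi' zj'.
- by apply/esym; exact: meet2 zj' zi'.
- exact: injJ (dg _ _ _ zi' zj').
Qed.

(** Induction on the number of arcs, for directed graphs: delete an arc from [x] to [y]. If fewer
    than [k] vertices [S] then separate, both [x |: S] and [y |: S] separate in [e] and have exactly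
    [k] vertices; by induction [A] is linked to the first and the second to [B] without that arc. *)
Theorem menger e A B k : irreflexive e ->
  (forall S, separator e A B S -> k <= #|S|) -> linked e A B k.
Proof.
have [n] := ubnP #|arcs e|; elim: n e A B => // n IHn e A B le_n irr sepk.
have [/existsP[[x y] /= exy]|/existsPn noe] := boolP [exists u, e u.1 u.2]; last first.
  (* Without arcs, [A :&: B] is a separator, and its vertices are trivial paths. *)
  have kAB : k <= #|A :&: B|.
    apply: sepk => a b aA bB aS _; apply/connectP=> -[[|c s] /= pp Eb].
      by rewrite inE aA -Eb bB in aS.
    by have := noe (a, c); case/andP: pp => /and3P[->].
  exists (fun i => (enum_val (widen_ord kAB i), [::])) => [i|i j z].
    by have := enum_valP (widen_ord kAB i); rewrite inE => /andP[].
  rewrite !inE => /eqP -> /eqP/enum_val_inj/(congr1 val) Eij.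
  exact: val_inj.
pose e' : rel T := fun a b => e a b && ((a, b) != (x, y)).
have sub : subrel e' e by move=> a b /andP[].
have irr' : irreflexive e' by move=> a; rewrite /e' irr.
have lt_e' : #|arcs e'| < n.
  rewrite -ltnS; apply: leq_trans le_n; rewrite ltnS.
  apply: proper_card; apply/properP; split.
    by apply/subsetP=> u; rewrite !inE => /andP[].
  by exists (x, y); rewrite inE //= /e' eqxx andbF.
have [|] := boolP [forall S : {set T}, (#|S| < k) ==> ~~
    [forall a in A, forall b in B, (a \notin S) && (b \notin S) ==>
      ~~ connect (delete e' S) a b]].
  move=> /forallP H; have [|f fP df] := IHn e' A B lt_e' irr'.
    move=> S sepS; rewrite leqNgt; have := H S; case: ltnP => //= _ /negP[].
    apply/forall_inP => a aA; apply/forall_inP => b bB; apply/implyP => /andP[].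
    exact: sepS.
  exists f => // i; case: (fP i) => ? p ? ?; split=> //.
  exact: sub_path p.
case/forallPn=> S; rewrite negb_imply negbK => /andP[Sk /forall_inP sepS0].
have sepS : separator e' A B S.
  move=> a b aA bB aS bS; have /forall_inP/(_ b bB) := sepS0 a aA.
  by rewrite aS bS.
have sepP z : z = x \/ z = y -> separator e A B (z |: S).
  move=> zxy a b aA bB; rewrite !inE !negb_or => /andP[_ aS] /andP[_ bS].
  move: (sepS _ _ aA bB aS bS); apply: contra; apply: connect_sub => u w /=.
  case/and3P=> euw; rewrite !inE !negb_or => /andP[uz uS] /andP[wz wS].
  apply: connect1; rewrite deleteE /e' euw uS wS !andbT /=; apply/eqP => -[Eu Ew].
  by case: zxy uz wz => ->; rewrite ?Eu ?Ew eqxx.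
have card z : z = x \/ z = y -> z \notin S /\ #|z |: S| = k.
  move=> zxy; have := sepk _ (sepP z zxy); rewrite cardsU1.
  case: (z \notin S) => /=; last by rewrite add0n leqNgt Sk.
  by rewrite add1n => le_k; split=> //; apply/eqP; rewrite eqn_leq Sk.
have [xS cP] := card x (or_introl erefl); have [yS cQ] := card y (or_intror erefl).
apply: (@glue_linked e e' A B S x y k) => //; apply: IHn => // R sepR.
(* A walk from [a] avoiding [R] never reaches [x |: S]: to use the deleted arc it would first have
   to be at [x], which [R] cuts off. So it cannot end in [B]. *)
- apply: sepk => a b aA bB aR bR; apply/negP => cab.
  have ca u : connect (delete e R) a u ->
      connect (delete e' R) a u /\ u \notin x |: S.
    move=> cau; suff cau' : connect (delete e' R) a u.
      split=> //; apply: contraL (cau') => uP; apply: sepR => //.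
      case/connectP: cau' => p; case/lastP: p => [_ -> //|p w].
      by rewrite rcons_path last_rcons => /andP[_ /and3P[_ _]] + ->.
    case/connectP: cau => p; elim/last_ind: p u => [|p w IHp] u.
      by move=> _ ->.
    rewrite rcons_path last_rcons => /andP[pp /and3P[ew uR wR]] ->.
    have cl := IHp _ pp erefl; apply: (connect_trans cl (connect1 _)).
    rewrite deleteE uR wR /e' ew !andbT /=; apply/eqP => -[Ex _].
    have := sepR a x aA (setU11 _ _) aR; rewrite -Ex uR => /(_ isT).
    by rewrite cl.
  have [_ bP] := ca b cab; have [_ aP] := ca a (connect0 _ _).
  have := sepP x (or_introl erefl) a b aA bB aP bP; rewrite (_ : connect _ _ _) //.
  apply: connect_sub_from cab => u w cu ruw.
  have [_ uP] := ca u cu; have [_ wP] := ca w (connect_trans cu (connect1 ruw)).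
  by rewrite deleteE uP wP; case/and3P: ruw => ->.
(* The mirror image, with walks followed backwards from [b] and the deleted arc blocked at [y]. *)
- apply: sepk => a b aA bB aR bR; apply/negP => cab.
  have ca u : connect (delete e R) u b ->
      connect (delete e' R) u b /\ u \notin y |: S.
    move=> cau; suff cau' : connect (delete e' R) u b.
      split=> //; apply: contraL (cau') => uP; apply: sepR => //.
      case/connectP: cau' => -[|w p] /=; first by move=> _ <-.
      by case/andP=> /and3P[].
    case/connectP: cau => p; elim: p u => [|w p IHp] u /=; first by move=> _ ->.
    case/andP=> /and3P[ew uR wR] pp Eb.
    have cl := IHp _ pp Eb; apply: (connect_trans (connect1 _) cl).
    rewrite deleteE uR wR /e' ew !andbT /=; apply/eqP => -[_ Ey].
    have := sepR y b (setU11 _ _) bB; rewrite -Ey wR bR => /(_ isT isT).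
    by rewrite cl.
  have [_ bP] := ca b (connect0 _ _); have [_ aP] := ca a cab.
  have := sepP y (or_intror erefl) a b aA bB aP bP; rewrite (_ : connect _ _ _) //.
  apply: connect_sub_to cab => u w cw ruw.
  have [_ wP] := ca w cw; have [_ uP] := ca u (connect_trans (connect1 ruw) cw).
  by rewrite deleteE uP wP; case/and3P: ruw => ->.
Qed.

End Menger.

(** * Fans *)

Section Fan.

Variables (T : finType) (e : rel T).

(** Each path starts at a neighbour of [v], so its full vertex sequence encodes its extension to
    [v]. The trivial path, allowed since [v] is in [U], is the extra one in [k.+1]. *)
Lemma linked_fan v (U : {set T}) k : irreflexive e -> v \in U ->
  linked (delete e [set v]) [set a | e v a] (U :\ v) k ->
  exists P, fan_to e k.+1 v U P.
Proof.
move=> irr vU [f fP df].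
have vf i : v \notin vertices (f i).
  case: (fP i); rewrite /vertices; case: (f i) => a s /=; rewrite inE => eva ps _ _.
  rewrite inE negb_or; apply/andP; split.
    by apply: contraTneq eva => <-; rewrite irr.
  elim: s a ps {eva} => //= b s IHs a /andP[/and3P[_ _ bv] ps].
  by rewrite inE negb_or eq_sym (IHs b) // andbT; move: bv; rewrite inE.
have bseqf i : exists q : #|T|.-bseq T, q = vertices (f i) :> seq T.
  have [_ _ /card_uniqP us _] := fP i.
  have sz : size (vertices (f i)) <= #|T| by rewrite -us max_card.
  by exists (Bseq sz).
have [q qf] := fin_all_exists bseqf.
have injq : injective q.
  move=> i j qij; apply: (df i j (f i).1); first exact: mem_head.
  by rewrite -qf -qij qf mem_head.
pose P := [bseq] |: [set q i | i : 'I_k].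
exists P; apply/andP; split; last first.
  apply/forall_inP => p; rewrite !inE => /predU1P[-> //|/imsetP[i _ ->]].
  by rewrite qf; case: (fP i) => _ _ _; rewrite inE => /andP[].
apply/and3P; split.
- rewrite cardsU1 card_imset // card_ord; case: imsetP => // -[i _ Ei].
  by have := qf i; rewrite -Ei.
- apply/forall_inP => p; rewrite !inE => /predU1P[-> //|/imsetP[i _ ->]].
  have vi := vf i; case: (fP i); rewrite qf inE => eva ps us _.
  rewrite /path_from cons_uniq vi [uniq _]us /= eva /= andbT.
  by apply: sub_path ps => a b /and3P[].
- apply/forall_inP => p pP; apply/forall_inP => r rP; apply/implyP.
  move: pP rP; rewrite !inE => /predU1P[-> _ _|/imsetP[i _ ->]].
    by rewrite disjoint_has.
  case/predU1P=> [-> _|/imsetP[j _ ->] nij].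
    by rewrite disjoint_sym disjoint_has.
  rewrite !qf disjoint_has; apply/hasPn => z zi; apply: contra nij => zj.
  by rewrite (df i j z).
Qed.

(** Menger's theorem is applied, with one vertex of [X] deleted, between its neighbours and the rest
    of [X]: a small separator would cut it off from another vertex of [X]. *)
Lemma inseparable_fan_set k X : irreflexive e ->
  inseparable e k X -> fan_set e k X.
Proof.
case: k => [|k] irr.
  move=> _; apply/forall_inP => x _; apply/existsP; exists set0.
  apply/andP; split; last by apply/forall_inP => p; rewrite inE.
  by apply/and3P; split; rewrite ?cards0 //; apply/forall_inP => p; rewrite inE.
case/andP=> kX /forall_inP insX; apply/forall_inP => v vX; apply/existsP.
apply: linked_fan => //; apply: menger => [a|S sepS]; first by rewrite deleteE irr.
rewrite leqNgt; apply/negP => Sk.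
have [y yX yS] : exists2 y, y \in X :\ v & y \notin S.
  apply/subsetPn; apply: contraL Sk => /subset_leq_card; rewrite -leqNgt.
  by apply: leq_trans; rewrite -ltnS (leq_trans kX) // (cardsD1 v X) vX.
have [yv yX'] := setD1P yX.
(* [S] may contain [v], which [separates] forbids; removing it is harmless, as a path without
   repetition never returns to [v]. *)
have /forall_inP/(_ y yX')/forallP/(_ (S :\ v)) := insX v vX.
have Sk1 : #|S :\ v| < k.+1.
  by rewrite ltnS (leq_trans _ (ltnW Sk)) // subset_leq_card // subD1set.
rewrite eq_sym yv Sk1 /separates !inE eqxx (negbTE yS) andbF /= negbK.
case/connectP=> p0 /shorten_path[p [pp up <- _]].
case: p pp up => [|a p] /=; first by move=> _ _ Ev; rewrite Ev eqxx in yv.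
case/andP=> /and3P[eva _ aS] pp /andP[vp _] Ey.
have pv z : z \in a :: p -> z != v by move=> zp; apply: contraNneq vp => <-.
have aS' : a \notin S by move: aS; rewrite !inE pv ?mem_head.
have: connect (delete (delete e [set v]) S) a y.
  apply/connectP; exists p => //; elim: p a pp pv {eva vp Ey aS} aS' => //= b p IHp a.
  case/andP=> /and3P[eab _ bS] pp pv aS'.
  have bS' : b \notin S by move: bS; rewrite !inE pv // inE mem_head orbT.
  rewrite !deleteE eab aS' bS' !inE !pv ?inE ?eqxx ?orbT //=.
  by apply: IHp => // z zp; apply: pv; rewrite inE zp orbT.
by apply/negP; apply: sepS; rewrite // inE.
Qed.

Lemma leq_beta_adm : irreflexive e -> beta e <= adm_infty e.
Proof.
move=> irr; case: (posnP (beta e)) => [-> //|b0].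
have [X /maxsetP[insX _]] := beta_attained e.
apply: (leq_adm (X := X)); last exact: inseparable_fan_set.
by rewrite -card_gt0 (leq_trans b0) //; case/andP: insX.
Qed.

(* The vertices of a fan path other than v, with v standing for the trivial
   path: distinct paths have disjoint supports. *)
Definition fan_support (v : T) (p : seq T) : seq T := if p is [::] then [:: v] else p.

Lemma fan_card_leq k v P (Q : {set #|T|.-bseq T}) (U : {set T}) :
  fan e k v P -> Q \subset P ->
  (forall p : #|T|.-bseq T, p \in Q -> exists2 z, z \in fan_support v p & z \in U) ->
  #|Q| <= #|U|.
Proof.
case/and3P=> _ /forall_inP pP /forall_inP dP /subsetP QP QU.
have QU' (p : #|T|.-bseq T) : exists z, p \in Q -> (z \in fan_support v p) && (z \in U).
  have [pQ|_] := boolP (p \in Q); last by exists v.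
  by have [z zp zU] := QU p pQ; exists z; rewrite zp.
have [f fP] := fin_all_exists QU'.
rewrite -(@card_in_imset _ _ f Q); last first.
  move=> p q pQ qQ Ef; apply/eqP; apply: contraT => npq.
  have /andP[fp _] := fP p pQ; have /andP[fq _] := fP q qQ.
  have /implyP/(_ npq) := forall_inP (dP _ (QP _ pQ)) _ (QP _ qQ).
  have /andP[_ /andP[vp _]] := pP _ (QP _ pQ).
  have /andP[_ /andP[vq _]] := pP _ (QP _ qQ).
  move: fp fq npq vp vq; rewrite Ef -val_eqE /= /fan_support.
  case: (val p) (val q) => [|a s] [|b t] //=.
  - by rewrite [_ \in [:: v]]inE => /eqP -> vb _ _; rewrite vb.
  - by rewrite [_ \in [:: v]]inE => va /eqP Ev; move: va; rewrite Ev => ->.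
  - by move=> fa fb _ _ _; rewrite disjoint_has => /hasPn/(_ _ fa); rewrite fb.
apply: subset_leq_card; apply/subsetP => _ /imsetP[p pQ ->].
by case/andP: (fP p pQ).
Qed.

End Fan.

(** * Tree-decompositions *)

Inductive tree (T : finType) := Node of {set T} & seq (tree T).

(** The generated principle gives no hypothesis on the children. Here the hypotheses form a product
    in [Type], because membership in [cs] needs the decidable equality that is derived from this
    principle. *)
Lemma tree_rect_foldr (T : finType) (P : tree T -> Type) :
  (forall V cs, foldr (fun c Q => P c * Q)%type unit cs -> P (Node V cs)) ->
  forall t, P t.
Proof.
move=> IH; fix rec 1 => -[V cs]; apply: IH.
by elim: cs => [|c cs IHcs] /=; [exact: tt | split; [exact: rec | exact: IHcs]].
Qed.

Lemma tree_comparable (T : finType) : comparable (tree T).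
Proof.
elim/tree_rect_foldr => V cs IH [W ds].
case: (V =P W) => [<-|nVW]; last by right; case.
suff [->|ncd] : decidable (cs = ds) by [left | right; case].
elim: cs ds IH => [|c cs IHcs] [|d ds] /=; try by [left | right].
case=> /(_ d)[<-|ncd]; last by right; case.
by case/(IHcs ds) => [<-|ncd]; [left | right; case].
Qed.

HB.instance Definition _ (T : finType) :=
  hasDecEq.Build (tree T) (compareP (@tree_comparable T)).

Lemma tree_ind_mem (T : finType) (P : tree T -> Prop) :
  (forall V cs, {in cs, forall c, P c} -> P (Node V cs)) -> forall t, P t.
Proof.
move=> IH; elim/tree_rect_foldr => V cs Pcs; apply: IH => c.
elim: cs Pcs => // d cs IHcs [Pd Pcs]; rewrite inE => /predU1P[-> //|].
exact: IHcs.
Qed.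

Section Tree.

Variables (T : finType) (k : nat).
Implicit Types (C D V W N R X : {set T}) (t u c : tree T) (cs : seq (tree T)).

Definition bag t := let: Node V _ := t in V.

Fixpoint verts t : {set T} :=
  let: Node V cs := t in foldr (fun c A => verts c :|: A) V cs.

Fixpoint covers (a b : T) t : bool :=
  let: Node V cs := t in (a \in V) && (b \in V) || has (covers a b) cs.

Fixpoint nodes t : nat := let: Node _ cs := t in (sumn (map nodes cs)).+1.

(* Base 3 makes the total drop when a bag is replaced by two smaller ones. *)
Definition bag_weight n := if k <= n then 3 ^ n else 0.

Fixpoint weight t : nat :=
  let: Node V cs := t in bag_weight #|V| + sumn (map weight cs).

(* The number of nodes strictly above the topmost bag containing s. *)
Fixpoint depth t (s : T) : nat :=
  let: Node V cs := t in
  if s \in V then 0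
  else foldr (fun c r => if s \in verts c then (depth c s).+1 else r) 0 cs.

(* The count condition and [V :&: verts c \subset bag c] together say that the
   bags containing a given vertex form a subtree. *)
Fixpoint wf t : bool :=
  let: Node V cs := t in
  [&& all wf cs,
      [forall x, (x \notin V) ==> (count (fun c => x \in verts c) cs <= 1)]
    & all (fun c => (V :&: verts c \subset bag c) && (#|V :&: verts c| < k)) cs].

(** The part of a tree on the side [C]. A vertex of [C :&: D] is also added to every bag above its
    occurrences, so that the parts for [C] and [D] can be joined at their roots. *)
Fixpoint split_tree C D t : tree T :=
  let: Node V cs := t in
  Node (V :&: C :|: C :&: D :&: verts t) (map (split_tree C D) cs).

Lemma in_verts V cs x :
  (x \in verts (Node V cs)) = (x \in V) || has (fun c => x \in verts c) cs.
Proof.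
elim: cs => [|c cs IH]; first by rewrite orbF.
have -> : verts (Node V (c :: cs)) = verts c :|: verts (Node V cs) by [].
by rewrite inE IH orbCA.
Qed.

Lemma bag_sub V cs x : x \in V -> x \in verts (Node V cs).
Proof. by rewrite in_verts => ->. Qed.

Lemma child_sub V cs c x : c \in cs -> x \in verts c -> x \in verts (Node V cs).
Proof. by move=> ccs xc; rewrite in_verts; apply/orP; right; apply/hasP; exists c. Qed.

Lemma wf_child V cs c : wf (Node V cs) -> c \in cs -> wf c.
Proof. by case/and3P=> /allP h _ _ /h. Qed.

Lemma wf_adhesion V cs c : wf (Node V cs) -> c \in cs ->
  (V :&: verts c \subset bag c) /\ #|V :&: verts c| < k.
Proof. by case/and3P=> _ _ /allP h /h/andP. Qed.

Lemma wf_count V cs x : wf (Node V cs) -> x \notin V ->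
  count (fun c => x \in verts c) cs <= 1.
Proof. by case/and3P=> _ /forallP h _ xV; apply: (implyP (h x)). Qed.

Lemma wf_cons V c cs x : wf (Node V (c :: cs)) -> x \notin V ->
  x \in verts c -> {in cs, forall c', x \notin verts c'}.
Proof.
move=> wft xV xc c' c'cs; have := wf_count wft xV; rewrite /= xc ltnS leqn0.
rewrite -leqn0 leqNgt -has_count; apply: contra => xc'.
by apply/hasP; exists c'.
Qed.

Lemma wf_perm V cs cs' : perm_eq cs cs' -> wf (Node V cs) = wf (Node V cs').
Proof.
move=> p /=; rewrite !(perm_all _ p); congr [&& _, _ & _].
by apply: eq_forallb => x; rewrite (permP p).
Qed.

Lemma covers_perm V cs cs' a b : perm_eq cs cs' ->
  covers a b (Node V cs) = covers a b (Node V cs').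
Proof. by move=> p /=; rewrite (perm_has _ p). Qed.

Lemma weight_perm V cs cs' : perm_eq cs cs' ->
  weight (Node V cs) = weight (Node V cs').
Proof. by move=> p /=; rewrite (perm_sumn (perm_map _ p)). Qed.

Lemma covers_sub a b t : covers a b t -> (a \in verts t) && (b \in verts t).
Proof.
elim/tree_ind_mem: t => V cs IH; rewrite [covers _ _ _]/=.
case/orP=> [/andP[aV bV]|/hasP[c ccs /(IH c ccs)/andP[ac bc]]].
  by rewrite !bag_sub.
by rewrite !(child_sub _ ccs).
Qed.

Lemma depth_bag t s : s \in bag t -> depth t s = 0.
Proof. by case: t => V cs /= ->. Qed.

Lemma depth_child V cs c s : wf (Node V cs) -> c \in cs -> s \in verts c ->
  s \notin V -> depth (Node V cs) s = (depth c s).+1.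
Proof.
move=> wft ccs sc sV; have := wf_count wft sV; rewrite /= (negbTE sV) {wft}.
elim: cs ccs => //= d cs IH; rewrite inE => /predU1P[<-|ccs]; first by rewrite sc.
case: ifP => [_|_ /IH-> //].
rewrite ltnS leqn0 -leqn0 leqNgt -has_count => /hasPn/(_ c ccs).
by rewrite sc.
Qed.

Lemma in_verts_split_tree C D t x : (x \in verts (split_tree C D t)) = (x \in verts t) && (x \in C).
Proof.
elim/tree_ind_mem: t x => V cs IH x; rewrite [split_tree _ _ _]/= -/(verts (Node V cs)).
have Eh : has (fun c => x \in verts c) (map (split_tree C D) cs)
    = has (fun c => x \in verts c) cs && (x \in C).
  rewrite has_map; elim: cs IH => //= c cs IHcs IH; rewrite IH ?mem_head //.
  by rewrite IHcs ?andb_orl // => d dcs; apply: IH; rewrite inE dcs orbT.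
rewrite in_verts Eh !in_setU !in_setI in_verts.
by case: (x \in V); case: (x \in C); case: (x \in D); case: (has _ _).
Qed.

Lemma covers_split_tree C D a b t : a \in C -> b \in C ->
  covers a b t -> covers a b (split_tree C D t).
Proof.
move=> aC bC; elim/tree_ind_mem: t => V cs IH; rewrite [split_tree _ _ _]/=.
case/orP=> [/andP[aV bV]|/hasP[c ccs abc]] /=.
  by rewrite !in_setU !in_setI aV bV aC bC.
by apply/orP; right; apply/hasP; exists (split_tree C D c); [exact: map_f | exact: IH].
Qed.

(** In the first case each term is at most [bag_weight n.-1], and twice this is at most
    [bag_weight n]; in the others one term vanishes. *)
Lemma bag_weight_split a b n :
  [\/ a < n /\ b < n, a <= n /\ b < k | a < k /\ b <= n] ->
  bag_weight a + bag_weight b <= bag_weight n.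
Proof.
have mono m l : m <= l -> bag_weight m <= bag_weight l.
  rewrite /bag_weight => ml; case: ifP => // km.
  by rewrite (leq_trans km ml) leq_exp2l.
have small m : m < k -> bag_weight m = 0 by rewrite /bag_weight ltnNge => /negbTE->.
case=> [[an bn]|[an /small->]|[/small-> bn]]; last 2 first.
- by rewrite addn0 mono.
- by rewrite add0n mono.
case: n an bn => // n; rewrite !ltnS => an bn.
apply: leq_trans (leq_add (mono _ _ an) (mono _ _ bn)) _.
rewrite /bag_weight; case: ifP => // kn; rewrite (leq_trans kn) // expnS addnn.
by rewrite -mul2n leq_mul2r orbT.
Qed.

Lemma bag_weight_split_lt a b n : k <= n -> a < n -> b < n ->
  bag_weight a + bag_weight b < bag_weight n.
Proof.
move=> kn an bn; rewrite {3}/bag_weight kn.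
have le m : m < n -> bag_weight m <= 3 ^ n.-1.
  by rewrite /bag_weight => mn; case: ifP => // _; rewrite leq_exp2l // -ltnS (ltn_predK an).
apply: leq_ltn_trans (leq_add (le _ an) (le _ bn)) _.
by rewrite -{3}(ltn_predK an) expnS addnn -mul2n ltn_mul2r expn_gt0.
Qed.

End Tree.

(** * Splitting along a separation *)

Section Separation.

Variables (T : finType) (e : rel T) (k : nat).
Implicit Types (C D V W N R X : {set T}) (t u c : tree T) (cs : seq (tree T)).

(** The case [a == b] makes [C] and [D] cover all vertices; the case [e a b] excludes edges between
    [C :\: D] and [D :\: C]. *)
Definition separation C D : bool :=
  [forall a, forall b, (a == b) || e a b ==>
     ((a \in C) && (b \in C)) || ((a \in D) && (b \in D))].

Definition splits W C D : bool :=
  [&& separation C D, k <= #|W :&: C|, k <= #|W :&: D| & #|C :&: D| < k].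

Lemma separationP C D : reflect (forall a b, (a == b) || e a b ->
  (a \in C) && (b \in C) || (a \in D) && (b \in D)) (separation C D).
Proof.
apply: (iffP forallP) => [h a b ab|h a]; first by have /forallP/(_ b)/implyP := h a; apply.
by apply/forallP => b; apply/implyP; exact: h.
Qed.

Lemma separation_cover C D x : separation C D -> (x \in C) || (x \in D).
Proof. by move=> /separationP/(_ x x); rewrite eqxx !andbb => /(_ isT). Qed.

Lemma separationC C D : separation C D = separation D C.
Proof.
by apply/separationP/separationP => h a b ab; rewrite orbC h.
Qed.

Lemma splitsC W C D : splits W C D = splits W D C.
Proof. by rewrite /splits separationC (setIC C D); congr (_ && _); rewrite andbCA. Qed.

(** With [w] the depth in a tree whose root bag is [W], the separator [C :&: D] is as close to [W]
    as possible. *)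
Definition tight (w : T -> nat) W C D : Prop :=
  splits W C D /\ forall C' D', splits W C' D' ->
    \sum_(s in C :&: D) w s <= \sum_(s in C' :&: D') w s.

Lemma tightC w W C D : tight w W C D -> tight w W D C.
Proof. by case=> s m; split=> [|C' D' /m]; rewrite 1?splitsC // setIC. Qed.

Lemma tight_exists w W C0 D0 : splits W C0 D0 -> exists C D, tight w W C D.
Proof.
move=> sCD; pose P (p : {set T} * {set T}) := splits W p.1 p.2.
pose F (p : {set T} * {set T}) := \sum_(s in p.1 :&: p.2) w s.
have : P (C0, D0) by [].
case/(@arg_minnP _ (C0, D0) P F) => -[C D] PCD minF.
by exists C, D; split=> // C' D' sCD'; exact: (minF (C', D')).
Qed.

Lemma ltn_sum_set (w : T -> nat) (A B : {set T}) : #|A| <= #|B| -> B != set0 ->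
  {in B, forall b, 0 < w b} -> {in A & B, forall a b, w a < w b} ->
  \sum_(a in A) w a < \sum_(b in B) w b.
Proof.
(* [m] lies between the two ranges of weights. It is 0 if [A] is empty, and the weights on [B] are
   still at least [m.+1] by [wB]. *)
move=> cAB B0 wB wAB; pose m := \max_(a in A) w a.
have leA : \sum_(a in A) w a <= #|A| * m.
  by rewrite -sum_nat_const leq_sum // => a aA; exact: leq_bigmax_cond.
have geB : #|B| * m.+1 <= \sum_(b in B) w b.
  rewrite -sum_nat_const leq_sum // => b bB.
  rewrite -(ltn_predK (wB b bB)) ltnS; apply/bigmax_leqP => a aA.
  by rewrite -ltnS (ltn_predK (wB b bB)) wAB.
apply: leq_ltn_trans leA (leq_trans _ geB).
apply: leq_ltn_trans (leq_mul cAB (leqnn m)) _.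
by rewrite ltn_mul2l card_gt0 B0 ltnSn.
Qed.

(* Pushing the part of D inside R to the other side replaces the separator's
   part in R by the part of N in D \ C, which would lower its total weight. *)
Lemma tight_exchange w W C D R N : symmetric e -> tight w W C D ->
  (forall a b, e a b -> a \in R -> b \in R :|: N) ->
  [disjoint R & N] -> [disjoint R & W] -> {in R, forall r, 0 < w r} ->
  {in N & R, forall n r, w n < w r} ->
  C :&: D :&: R != set0 -> #|C :&: D :&: R| < #|N :&: (D :\: C)|.
Proof.
move=> e_sym [/and4P[sCD kC kD kS] min] eR dRN dRW wR wNR E0.
rewrite ltnNge; apply/negP => leE.
pose C' := C :|: (D :&: (R :|: N)); pose D' := D :\: R.
have RN x : x \in R -> x \notin N by move=> xR; rewrite (disjointFr dRN).
have RW x : x \in R -> x \notin W by move=> xR; rewrite (disjointFr dRW).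
have ES : C' :&: D' = (C :&: D :\: R) :|: (N :&: (D :\: C)).
  apply/setP=> x; rewrite !inE; have := separation_cover x sCD; have := RN x.
  by case: (x \in C); case: (x \in D); case: (x \in R); case: (x \in N).
have dS : [disjoint C :&: D :\: R & N :&: (D :\: C)].
  by rewrite -setI_eq0; apply/eqP/setP=> x; rewrite !inE; case: (x \in C); rewrite ?andbF.
have dS2 : C :&: D = (C :&: D :\: R) :|: (C :&: D :&: R) by rewrite setUC setID.
have dS2' : [disjoint C :&: D :\: R & C :&: D :&: R].
  by rewrite -setI_eq0; apply/eqP/setP=> x; rewrite !inE; case: (x \in R); rewrite ?andbF.
have sp : splits W C' D'.
  apply/and4P; split.
  (* An edge with an end in [R] lies inside [R :|: N], hence inside [C']; any other edge keeps its
     side, since [D] loses only [R]. *)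
  - apply/separationP => a b ab.
    have inC' x : x \in R :|: N -> x \in C'.
      move=> xRN; have := separation_cover x sCD; rewrite !inE in xRN *.
      by rewrite xRN andbT.
    have [aR|aR] := boolP (a \in R).
      have bRN : b \in R :|: N.
        case/predU1P: ab => [<-|/eR]; [by rewrite inE aR | exact].
      by rewrite !inC' // inE aR.
    have [bR|bR] := boolP (b \in R).
      have aRN : a \in R :|: N.
        case/predU1P: ab => [->|]; [by rewrite inE bR | rewrite e_sym => /eR; exact].
      by rewrite !inC' // inE bR.
    have /separationP/(_ a b ab) := sCD; rewrite !inE aR bR /=.
    by case/orP=> /andP[-> ->] //; rewrite orbT.
  - by apply: leq_trans kC _; rewrite subset_leq_card // setIS // subsetUl.
  - apply: leq_trans kD _; rewrite subset_leq_card //; apply/subsetP => x.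
    by rewrite !inE => /andP[xW ->]; rewrite xW; case: (boolP (x \in R)) => // /RW; rewrite xW.
  - apply: leq_ltn_trans kS; rewrite ES [in leqRHS]dS2 !cardsU.
    by rewrite (disjoint_setI0 dS) (disjoint_setI0 dS2') !cards0 !subn0 leq_add2l.
have sumU (A B : {set T}) : [disjoint A & B] ->
    \sum_(s in A :|: B) w s = \sum_(s in A) w s + \sum_(s in B) w s.
  by move=> dAB; rewrite -bigU //; apply: eq_bigl => x; rewrite !inE.
have := min _ _ sp; rewrite ES [in leqLHS]dS2 !sumU // leq_add2l leqNgt.
rewrite ltn_sum_set // => [r|n r]; rewrite !inE.
  by case/andP=> _; exact: wR.
by move=> /andP[nN _] /andP[_ rR]; exact: wNR.
Qed.

(* [u] sits below the bag [N] at level [d] of a tree whose depth is [w]. *)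
Record subtree_at (w : T -> nat) N (d : nat) u : Prop := SubtreeAt {
  sub_wf : wf k u;
  sub_top : N :&: verts u \subset bag u;
  sub_cov : forall a b, e a b -> a \in verts u -> a \notin N -> covers a b u;
  sub_depth : forall s, s \in verts u -> s \notin N -> w s = d + depth u s;
  sub_low : forall n, n \in N -> w n < d
}.

(** A vertex of a child outside [V] lies in no other child, so an edge at it can only be covered
    inside this child. *)
Lemma subtree_child w N d V cs c : subtree_at w N d (Node V cs) ->
  c \in cs -> subtree_at w V d.+1 c.
Proof.
case=> wfu top cov dep low ccs.
have NV x : x \in N -> x \in verts c -> x \in V.
  move=> xN xc; apply: (subsetP top).
  by rewrite inE xN (child_sub V ccs).
split.
- exact: wf_child wfu ccs.
- by case: (wf_adhesion wfu ccs).
- move=> a b eab ac aV.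
  have aN : a \notin N by apply: contra aV => /NV; exact.
  have := cov a b eab (child_sub V ccs ac) aN.
  rewrite /= (negbTE aV) /= => /hasP[c' c'cs abc'].
  have /andP[ac' _] := covers_sub abc'.
  have [<- //|cc'] := eqVneq c' c.
  have /wf_cons/(_ aV ac)/(_ c') : wf k (Node V (c :: rem c cs)).
    by rewrite -(wf_perm _ _ (perm_to_rem ccs)).
  rewrite ac' => /(_ _)/negP; case => //.
  by have := c'cs; rewrite (perm_mem (perm_to_rem ccs)) inE (negbTE cc').
- move=> s sc sV; have sN : s \notin N by apply: contra sV => /NV; exact.
  by rewrite (dep s (child_sub V ccs sc) sN) (depth_child wfu ccs) // addnS.
- move=> n nV; have [/low/ltnW //|nN] := boolP (n \in N).
  by rewrite dep ?bag_sub // depth_bag // addn0.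
Qed.

Section Split.

Variables (w : T -> nat) (W C D : {set T}).
Hypotheses (e_sym : symmetric e) (tCD : tight w W C D).
Hypothesis (wW : {in W, forall x, w x = 0}).

Lemma tight_cover x : (x \in C) || (x \in D).
Proof. by case: tCD => /and4P[/separation_cover]. Qed.

(** Exchange with [R] the vertices of the subtree outside its top bag and [N] that bag: [w] exceeds
    [d] on [R] and is at most [d] on [V]. So fewer separator vertices are lifted into the bag than
    it loses to [D :\: C]. *)
Lemma subtree_bag N d V cs : subtree_at w N d (Node V cs) ->
  C :&: D :&: (verts (Node V cs) :\: V) != set0 ->
  #|C :&: D :&: (verts (Node V cs) :\: V)| < #|V :&: (D :\: C)|.
Proof.
move=> inv; have [wfu top cov dep low] := inv.
have RN x : x \in verts (Node V cs) :\: V -> x \notin N.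
  case/setDP=> xu xV; apply: contra xV => xN.
  by apply: (subsetP top); rewrite inE xN.
have wR r : r \in verts (Node V cs) :\: V -> d < w r.
  move=> rR; have /setDP[ru rV] := rR.
  rewrite (dep r ru (RN r rR)) /= (negbTE rV).
  have := ru; rewrite in_verts (negbTE rV) /= => /hasP[c ccs rc].
  have := depth_child wfu ccs rc rV; rewrite /= (negbTE rV) => ->.
  by rewrite addnS ltnS leq_addr.
apply: (tight_exchange (w := w) (W := W)) => //.
- move=> a b eab aR; have /setDP[au aV] := aR.
  have /andP[_ bu] := covers_sub (cov a b eab au (RN a aR)).
  by rewrite !inE bu andbT; case: (b \in V).
- by rewrite -setI_eq0; apply/eqP/setP=> x; rewrite !inE; case: (x \in V); rewrite ?andbF.
- rewrite disjoint_subset; apply/subsetP => x /wR wx; apply/negP => xW.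
  by rewrite wW in wx.
- by move=> r /wR; apply: leq_ltn_trans.
- move=> n r nV /wR; apply: leq_ltn_trans.
  have [/low/ltnW //|nN] := boolP (n \in N).
  by rewrite dep ?bag_sub // depth_bag // addn0.
Qed.

(** The same exchange for a single child, with the adhesion set as [N]; it keeps the adhesion below
    [k] after splitting. *)
Lemma subtree_adhesion N d V cs c : subtree_at w N d (Node V cs) ->
  c \in cs -> C :&: D :&: (verts c :\: V) != set0 ->
  #|C :&: D :&: (verts c :\: V)| < #|V :&: verts c :&: (D :\: C)|.
Proof.
move=> inv ccs; have [wfu top cov dep low] := subtree_child inv ccs.
have wR r : r \in verts c :\: V -> d < w r.
  by case/setDP=> rc rV; rewrite dep // leq_addr.
apply: (tight_exchange (w := w) (W := W)) => //.
- move=> a b eab /setDP[ac aV].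
  have /andP[_ bc] := covers_sub (cov a b eab ac aV).
  by rewrite !inE bc !andbT; case: (b \in V).
- by rewrite -setI_eq0; apply/eqP/setP=> x; rewrite !inE; case: (x \in V); rewrite ?andbF.
- rewrite disjoint_subset; apply/subsetP => x /wR wx; apply/negP => xW.
  by rewrite wW in wx.
- by move=> r /wR; apply: leq_ltn_trans.
- by move=> n r; rewrite inE => /andP[nV _] /wR; apply: leq_ltn_trans; rewrite -ltnS low.
Qed.

(** The new bag loses [V :&: (D :\: C)] and gains the lifted vertices, which are fewer if there are
    any. [V] stands for a bag or for an adhesion set. *)
Lemma card_split_bag V (A : {set T}) :
  (C :&: D :&: (A :\: V) != set0 ->
   #|C :&: D :&: (A :\: V)| < #|V :&: (D :\: C)|) ->
  #|V :&: C :|: C :&: D :&: A| <= #|V| /\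
  (~~ (V \subset C) || (C :&: D :&: (A :\: V) != set0) ->
   #|V :&: C :|: C :&: D :&: A| < #|V|).
Proof.
move=> ex; have -> : V :&: C :|: C :&: D :&: A = (V :&: C) :|: (C :&: D :&: (A :\: V)).
  by apply/setP=> x; rewrite !inE; case: (x \in V); case: (x \in C); rewrite ?andbF ?orbF //= orbF.
have EV : #|V| = #|V :&: C| + #|V :&: (D :\: C)|.
  rewrite -(cardsID C V); congr (_ + _); apply: eq_card => x; rewrite !inE.
  by have := tight_cover x; case: (x \in C) => /= [_|->]; rewrite ?andbF ?andbT.
have leU := leq_card_setU (V :&: C) (C :&: D :&: (A :\: V)).
have [E0|/ex lt] := eqVneq (C :&: D :&: (A :\: V)) set0; last first.
  have lt2 : #|(V :&: C) :|: (C :&: D :&: (A :\: V))| < #|V|.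
    by apply: leq_ltn_trans leU _; rewrite EV ltn_add2l.
  by split=> //; exact: ltnW.
rewrite E0 setU0 orbF subset_leq_card ?subsetIl //; split=> // nVC.
by rewrite proper_card // properE subsetIl subsetI subxx.
Qed.

End Split.

Lemma wf_split w W C D : symmetric e -> tight w W C D ->
  {in W, forall x, w x = 0} ->
  forall u N d, subtree_at w N d u -> wf k (split_tree C D u).
Proof.
move=> e_sym tCD wW; elim/tree_ind_mem => V cs IH N d inv.
have wfu := sub_wf inv.
have Es : split_tree C D (Node V cs) =
  Node (V :&: C :|: C :&: D :&: verts (Node V cs)) (map (split_tree C D) cs) by [].
rewrite Es; apply/and3P; split.
- rewrite all_map; apply/allP => c ccs /=.
  exact: IH (subtree_child inv ccs).
- apply/forallP => x; apply/implyP => xV; rewrite count_map.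
  have [xC|xC] := boolP (x \in C); last first.
    rewrite (eq_count (a2 := pred0)) ?count_pred0 // => c /=.
    by rewrite in_verts_split_tree (negbTE xC) andbF.
  apply: leq_trans (sub_count _ _) (wf_count (x := x) wfu _).
    by move=> c /=; rewrite in_verts_split_tree => /andP[].
  by apply: contra xV => xV; rewrite !inE xV xC.
- rewrite all_map; apply/allP => c ccs /=.
  have [top adh] := wf_adhesion wfu ccs; apply/andP; split.
    apply/subsetP => x; rewrite inE in_verts_split_tree => /andP[xV /andP[xc xC]].
    move: top xc xV; case: c ccs {adh} => Vc cc ccs /= /subsetP top xc.
    rewrite !inE xC andbT; case/orP=> [xV|/andP[xD _]]; last first.
      by rewrite xD /= xc orbT.
    by rewrite top // inE xV.
  apply: leq_ltn_trans adh.
  (* The adhesion set takes the place of the bag in [card_split_bag]. *)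
  have Ec : verts c :\: (V :&: verts c) = verts c :\: V.
    by apply/setP=> x; rewrite !inE; case: (x \in V); case: (x \in verts c).
  have := subtree_adhesion e_sym tCD wW inv ccs; rewrite -Ec.
  case/(card_split_bag tCD) => le _.
  apply: leq_trans le; rewrite subset_leq_card //; apply/subsetP => x.
  rewrite 2!inE in_verts_split_tree => /andP[+ /andP[xc xC]].
  rewrite !inE xc xC !andbT /=.
  by case/orP=> [->|/andP[-> _]]; rewrite ?orbT.
Qed.

Lemma weight_split w W C D : symmetric e -> tight w W C D ->
  {in W, forall x, w x = 0} ->
  forall u N d, subtree_at w N d u ->
  weight k (split_tree C D u) + weight k (split_tree D C u) <= weight k u.
Proof.
move=> e_sym tCD wW; elim/tree_ind_mem => V cs IH N d inv.
have {IH} le : sumn (map (weight k) (map (split_tree C D) cs))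
    + sumn (map (weight k) (map (split_tree D C) cs)) <= sumn (map (weight k) cs).
  have : {in cs, forall c, weight k (split_tree C D c) + weight k (split_tree D C c) <= weight k c}.
    by move=> c ccs; exact: IH (subtree_child inv ccs).
  elim: cs {IH inv} => //= c cs IH le; rewrite addnACA leq_add ?le ?mem_head //.
  by apply: IH => d' d'cs; apply: le; rewrite inE d'cs orbT.
rewrite /= addnACA leq_add // -/(verts (Node V cs)).
set A := verts _; have exC := @subtree_bag w W C D e_sym tCD wW _ _ _ _ inv.
have exD := @subtree_bag w W D C e_sym (tightC tCD) wW _ _ _ _ inv.
have [leC ltC] := card_split_bag tCD exC.
have [leD ltD] := card_split_bag (tightC tCD) exD.
apply: bag_weight_split; rewrite -/A in exC exD leC ltC leD ltD *.
(* If vertices are lifted, or if [V] lies on neither side, both new bags are smaller than [V].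
   Otherwise [V] lies on one side, and the new bag for the other side is inside [C :&: D], too small
   to have weight. *)
have [E0|E0] := eqVneq (C :&: D :&: (A :\: V)) set0; last first.
  constructor 1; split; [apply: ltC | apply: ltD; rewrite (setIC D)];
  by rewrite E0 orbT.
have small : forall C D, #|C :&: D| < k -> V \subset C -> C :&: D :&: (A :\: V) = set0 ->
    #|V :&: D :|: D :&: C :&: A| < k.
  move=> C' D' kS VC' E; apply: leq_ltn_trans kS; rewrite subset_leq_card //.
  apply/subsetP => x; rewrite !inE => /orP[/andP[xV ->]|/andP[/andP[-> ->] _]] //.
  by rewrite (subsetP VC').
have kS : #|C :&: D| < k by case: tCD => /and4P[].
have [VC|VC] := boolP (V \subset C); first by constructor 2; split=> //; exact: small.
have [VD|VD] := boolP (V \subset D).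
  by constructor 3; split=> //; apply: small => //; rewrite 1?(setIC D).
by constructor 1; split; [apply: ltC; rewrite VC | apply: ltD; rewrite VD].
Qed.

End Separation.

(** * Decompositions of the graph: refining along a separation, and re-rooting *)

Section FanSet.

Variables (T : finType) (e : rel T) (k : nat).
Hypothesis e_sym : symmetric e.
Implicit Types (C D V W X Y : {set T}) (t c p : tree T) (cs : seq (tree T)).

Definition decomposition t : Prop :=
  wf k t /\ forall a b, (a == b) || e a b -> covers a b t.

Lemma decomposition_verts t x : decomposition t -> x \in verts t.
Proof. by case=> _ /(_ x x); rewrite eqxx => /(_ isT)/covers_sub/andP[]. Qed.

(** The part for [D] is hung below the root of the part for [C]. As the tree contains all vertices,
    both root bags contain [C :&: D], which becomes the new adhesion set. The weight drops strictly
    at the root. *)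
Lemma decomposition_split W cs C0 D0 : decomposition (Node W cs) ->
  splits e k W C0 D0 ->
  exists2 t, decomposition t & weight k t < weight k (Node W cs).
Proof.
move=> dec /(tight_exists (depth (Node W cs)))[C [D tCD]].
set t := Node W cs in tCD *; set w := depth t in tCD.
have vt x : x \in verts t by exact: decomposition_verts.
have [wft cov] := dec.
have wW : {in W, forall x, w x = 0} by move=> x xW; exact: depth_bag.
have inv : subtree_at e k w set0 0 t.
  split=> [//||a b eab _ _|//|n]; rewrite ?inE //; last first.
    by apply: cov; rewrite eab orbT.
  by apply/subsetP => x; rewrite inE in_set0.
have tDC := tightC tCD.
have [/and4P[sep kC kD kS] _] := tCD.
have wfC := wf_split e_sym tCD wW inv; have wfD := wf_split e_sym tDC wW inv.
exists (Node (W :&: C :|: C :&: D :&: verts t)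
             (split_tree D C t :: map (split_tree C D) cs)).
  split=> [|a b ab].
    case/and3P: (wfC) => allC cntC adhC; apply/and3P; split.
    - by apply/andP; split; [exact: wfD | exact: allC].
    - apply/forallP => x; apply/implyP => xV.
      rewrite -[count _ _]/((x \in verts (split_tree D C t)) +
        count (fun c => x \in verts c) (map (split_tree C D) cs)).
      rewrite in_verts_split_tree vt andTb.
      have [xD|xD] := boolP (x \in D); last first.
        by rewrite add0n; apply: (implyP (forallP cntC x)).
      rewrite -[X in _ <= X]addn0 leq_add2l leqn0 eqn0Ngt -has_count.
      apply/hasPn => _ /mapP[c ccs ->]; rewrite in_verts_split_tree.
      apply: contra xV => /andP[_ xC]; by rewrite !inE xC xD vt orbT.
    - apply/andP; split; last by exact: adhC.
      have sub : (W :&: C :|: C :&: D :&: verts t) :&: verts (split_tree D C t)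
          \subset C :&: D.
        apply/subsetP => x; rewrite inE in_verts_split_tree => /andP[+ /andP[_ xD]].
        by rewrite !inE xD => /orP[/andP[_ ->]|/andP[/andP[->]]].
      rewrite (leq_ltn_trans (subset_leq_card sub) kS) andbT.
      apply: subset_trans sub _; apply/subsetP => x; rewrite inE => /andP[xC xD].
      by rewrite !inE xC xD vt orbT.
  have /separationP/(_ a b ab)/orP[/andP[aC bC]|/andP[aD bD]] := sep.
    have := covers_split_tree D aC bC (cov a b ab); rewrite /= => /orP[->//|h].
    by rewrite h !orbT.
  apply/orP; right; apply/orP; left.
  exact: covers_split_tree (cov a b ab).
have card_lt C' D' : tight e k w W C' D' ->
    #|W :&: C' :|: C' :&: D' :&: verts t| < #|W|.
  move=> tCD'; have [/and4P[_ _ kD' kS'] _] := tCD'.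
  have [_ ->//] := card_split_bag tCD' (subtree_bag e_sym tCD' wW inv).
  (* If [W] were inside [C'], the at least [k] vertices of [W :&: D'] would all be in the
     separator. *)
  apply/orP; left; apply/negP => WC'.
  have : #|W :&: D'| <= #|C' :&: D'| by rewrite subset_leq_card // setSI.
  by rewrite leqNgt (leq_trans kS').
have := bag_weight_split_lt _ (card_lt _ _ tCD) (card_lt _ _ tDC).
move=> /(_ k); rewrite (leq_trans kC) ?subset_leq_card ?subsetIl // => /(_ isT) lt.
have le : sumn (map (weight k) (map (split_tree C D) cs))
    + sumn (map (weight k) (map (split_tree D C) cs)) <= sumn (map (weight k) cs).
  have : {in cs, forall c, weight k (split_tree C D c) + weight k (split_tree D C c)
      <= weight k c}.
    by move=> c ccs; exact: weight_split e_sym tCD wW _ _ _ (subtree_child inv ccs).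
  elim: cs {t w tCD dec vt wft cov wW inv tDC sep kC kD kS wfC wfD card_lt lt}
    => //= c cs IH le; rewrite addnACA leq_add ?le ?mem_head //.
  by apply: IH => d dcs; apply: le; rewrite inE dcs orbT.
apply: leq_trans (leq_add lt le).
by rewrite addSn ltnS /= addnACA addnA addnAC leqnn.
Qed.

Lemma decomposition_perm V cs cs' : perm_eq cs cs' ->
  decomposition (Node V cs) -> decomposition (Node V cs').
Proof.
move=> p [wft cov]; split=> [|a b /cov]; first by rewrite -(wf_perm _ _ p).
by rewrite (covers_perm _ _ _ p).
Qed.

(** The two sides of the tree edge share only vertices of [W :&: V], so the adhesion set is the same
    from either end. *)
Lemma decomposition_reroot W V cs ds :
  decomposition (Node W (Node V ds :: cs)) ->
  decomposition (Node V (Node W cs :: ds)).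
Proof.
move=> [wft cov]; have [top adh] := wf_adhesion wft (mem_head _ _).
have wfc := wf_child wft (mem_head _ _).
have cntW x := wf_count (x := x) wft; have cntV x := wf_count (x := x) wfc.
have WV x : x \in W -> x \in verts (Node V ds) -> x \in V.
  by move=> xW xc; apply: (subsetP top); rewrite inE xW.
have meet x : x \in verts (Node W cs) -> x \in verts (Node V ds) ->
    (x \in W) && (x \in V).
  move=> xq xc; have [xW|xW] := boolP (x \in W); first by rewrite (WV x).
  have := wf_cons wft xW xc; move: xq; rewrite in_verts (negbTE xW) /=.
  by case/hasP=> c ccs xc' /(_ c ccs); rewrite xc'.
split=> [|a b /cov]; last first.
  by case/orP=> /= [->|/orP[/orP[->|->]|->]]; rewrite ?orbT.
case/and3P: (wft) => /andP[_ allW] _ /andP[_ adhW].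
case/and3P: (wfc) => allV _ adhV.
apply/and3P; split.
- apply/andP; split=> //; apply/and3P; split=> //.
  apply/forallP => x; apply/implyP => xW; apply: leq_trans (cntW x xW).
  by rewrite /= leq_addl.
- apply/forallP => x; apply/implyP => xV.
  rewrite -[count _ _]/((x \in verts (Node W cs)) + count (fun c => x \in verts c) ds).
  have [xq|xq] := boolP (x \in verts (Node W cs)); last exact: cntV.
  rewrite -[X in _ <= X]addn0 leq_add2l leqn0 eqn0Ngt -has_count.
  apply/hasPn => c cds; apply: contra xV => xc.
  by have /andP[] := meet x xq (child_sub V cds xc).
- apply/andP; split=> //.
  have sub : V :&: verts (Node W cs) \subset W :&: verts (Node V ds).
    apply/subsetP => x /setIP[xV xq].
    have xc : x \in verts (Node V ds) by rewrite bag_sub.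
    by have /andP[xW _] := meet x xq xc; apply/setIP.
  rewrite (leq_ltn_trans (subset_leq_card sub) adh) andbT.
  exact: subset_trans sub (subsetIl _ _).
Qed.

(* Re-root towards X until the side of the root bag away from the first
   child p meets X in the root bag only. *)
Lemma decomposition_leaf X W p cs :
  decomposition (Node W (p :: cs)) -> X :\: verts p != set0 ->
  exists W' p' cs', [/\ decomposition (Node W' (p' :: cs')),
    weight k (Node W' (p' :: cs')) = weight k (Node W (p :: cs)),
    X :\: verts p' != set0
    & {in cs', forall c, X :&: verts c \subset W'}].
Proof.
(* The measure counts the nodes outside [p]; it decreases when the root moves to a child in [cs] and
   the old root joins the side of [p]. *)
have [n] := ubnP (nodes (Node W cs)); elim: n W p cs => // n IH W p cs le_n dec X0.
have [/allP sub|] := boolP (all (fun c => X :&: verts c \subset W) cs).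
  by exists W, p, cs.
case/allPn=> -[V ds] ccs /subsetPn[x /setIP[xX xc] xW].
have perm : perm_eq (p :: cs) (Node V ds :: p :: rem (Node V ds) cs).
  rewrite perm_sym -[Node V ds :: p :: _]/([:: Node V ds; p] ++ _).
  rewrite (perm_catCA [:: Node V ds] [:: p]) /= perm_cons.
  by rewrite perm_sym perm_to_rem.
have dec' := decomposition_perm perm dec.
have [] := IH _ _ _ _ (decomposition_reroot dec').
- rewrite -ltnS; apply: leq_trans le_n; rewrite ltnS.
  rewrite -[nodes (Node W cs)]/(sumn (map (@nodes T) cs)).+1.
  by rewrite (perm_sumn (perm_map _ (perm_to_rem ccs))) ltnS leq_addr.
- have wfr := dec'.1; apply/set0Pn; exists x.
  rewrite inE xX andbT; apply/negP; rewrite in_verts (negbTE xW) => /hasP[c' c'r xc'].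
  by have := wf_cons wfr xW xc c'r; rewrite xc'.
move=> W' [p' [cs' [dec2 w2 X2 sub2]]]; exists W', p', cs'; split=> //.
rewrite w2 (weight_perm _ _ perm) /=.
set m := weight k p + _; set d := sumn (map _ ds).
by rewrite -[_ + m + d]addnA addnCA (addnC m) (addnA _ d).
Qed.

End FanSet.

(** * Fan-sets contain inseparable sets *)

Section FanCount.

Variables (T : finType) (e : rel T) (k m : nat) (X W : {set T}) (p : tree T)
  (cs : seq (tree T)).
Hypotheses (e_sym : symmetric e) (km : k.*2 <= m.+1).
Hypotheses (fanX : fan_set e m X) (dec : decomposition e k (Node W (p :: cs))).
Hypothesis leafX : {in cs, forall c, X :&: verts c \subset W}.
Implicit Types (S C D : {set T}).

Lemma leaf_root x : x \in X -> x \notin verts p -> x \in W.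
Proof.
move=> xX xp; have := decomposition_verts x dec; rewrite in_verts /= (negbTE xp) /=.
case/orP=> // /hasP[c ccs xc]; apply: (subsetP (leafX ccs)).
by rewrite inE xX.
Qed.

(** The first vertex of the path in [verts p] is in [W]: the edge entering there is not covered
    inside [p], and any other child shares with [p] only vertices of [W]. *)
Lemma path_cross y s : path e y s -> y \notin verts p -> last y s \in verts p ->
  exists2 z, z \in s & z \in W :&: verts p.
Proof.
elim: s y => [|b s IH] y /=; first by move=> _ /negbTE->.
case/andP=> eyb ps yp lp; have [bp|bp] := boolP (b \in verts p); last first.
  by have [z zs zW] := IH b ps bp lp; exists z; rewrite // inE zs orbT.
exists b; rewrite ?mem_head // inE bp andbT.
have := dec.2 y b; rewrite eyb orbT => /(_ isT) /=.
case/or3P=> [/andP[]//|/covers_sub/andP[yp'] _|/hasP[c ccs /covers_sub/andP[_ bc]]].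
  by rewrite yp' in yp.
apply: contraT => bW; have := wf_cons dec.1 bW bp ccs.
by rewrite bc.
Qed.

(** By [fan_card_leq] at most [k - 1] paths meet [S], and [km] leaves at least [k] of the [m]
    paths. *)
Lemma fan_avoiding v P S : fan e m v P -> v \notin S -> #|S| < k ->
  k <= #|[set q in P | [disjoint (q : seq T) & S]]|.
Proof.
move=> fP vS Sk; set Q := [set q in P | _].
have cQ : #|P :\: Q| <= #|S|.
  apply: (fan_card_leq fP (subsetDl _ _)) => q.
  rewrite !inE negb_and => /andP[+ qP]; rewrite qP /= => /pred0Pn[z /andP[/= zq zS]].
  by exists z => //; case: (val q) zq.
have QP : Q \subset P by apply/subsetP=> q; rewrite inE => /andP[].
have /and3P[/eqP cP _ _] := fP.
have := cardsID Q P; rewrite (setIidPr QP) cP => cm.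
have : k + k <= #|Q| + k; last by rewrite leq_add2r.
rewrite addnn (leq_trans km) // -cm -addnS leq_add2l.
exact: leq_trans Sk.
Qed.

(** A path ending in [verts p] crosses [W] on its way in; any other ends in [W] by [leaf_root]. *)
Lemma fan_hits_root v q : path_from e v q -> last v q \in X ->
  v \in X -> v \notin verts p ->
  exists2 z, z \in fan_support v q & z \in W.
Proof.
case/andP=> pq _ lX vX vp; have [lp|lp] := boolP (last v q \in verts p).
  have [z zq /setIP[zW _]] := path_cross pq vp lp.
  by exists z => //; case: q zq {pq lX lp}.
exists (last v q); last exact: leaf_root.
by case: q {pq lX lp} => [|a s] /=; [exact: mem_head | exact: mem_last].
Qed.

(** The fan paths that avoid [S] stay in the component of [v], and each contributes its own vertex
    of [W]. *)
Lemma card_root_side S C v : v \in X -> v \notin verts p -> v \notin S ->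
  #|S| < k -> (forall z, connect (delete e S) v z -> z \in C) ->
  k <= #|W :&: C|.
Proof.
move=> vX vp vS Sk vC; have /existsP[P /andP[fP /forall_inP lP]] := forall_inP fanX _ vX.
apply: leq_trans (fan_avoiding fP vS Sk) _.
have /and3P[_ /forall_inP pP _] := fP.
apply: (fan_card_leq fP) => [|q]; first by apply/subsetP=> q; rewrite inE => /andP[].
rewrite inE => /andP[qP dqS].
have [z zs zW] := fan_hits_root (pP q qP) (lP q qP) vX vp.
exists z => //; rewrite inE zW; apply: vC.
have /andP[pq _] := pP q qP.
have {pq} pq : path (delete e S) v q.
  by apply: path_delete => // x; rewrite inE => /predU1P[-> //|/(disjointFr dqS)->].
move: zs pq; case: (val q) => [|a s]; first by rewrite inE => /eqP->.
rewrite /fan_support => zs pq; apply: (path_connect pq).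
by rewrite inE zs orbT.
Qed.

(** The set to avoid is the adhesion set of [p]: the remaining fan paths cannot enter [verts p], so
    their distinct ends are counted. *)
Lemma card_leaf : X :\: verts p != set0 -> k <= #|X :\: verts p|.
Proof.
case/set0Pn=> v /setDP[vX vp].
have /existsP[P /andP[fP /forall_inP lP]] := forall_inP fanX _ vX.
have [_ adh] := wf_adhesion dec.1 (mem_head _ _).
have vS : v \notin W :&: verts p by rewrite inE (negbTE vp) andbF.
apply: leq_trans (fan_avoiding fP vS adh) _.
have /and3P[_ /forall_inP pP _] := fP.
apply: (fan_card_leq fP) => [|q]; first by apply/subsetP=> q; rewrite inE => /andP[].
rewrite inE => /andP[qP dqS]; exists (last v q).
  by case: (val q) => [|a s] /=; [exact: mem_head | exact: mem_last].
rewrite inE lP // andbT; apply/negP => lp.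
have /andP[pq _] := pP q qP; have [z zq zS] := path_cross pq vp lp.
by rewrite (disjointFr dqS zq) in zS.
Qed.

Lemma leaf_splits : ~~ inseparable e k (X :\: verts p) -> X :\: verts p != set0 ->
  exists C D, splits e k W C D.
Proof.
move=> ins X0; move: ins; rewrite /inseparable card_leaf //=.
case/forallPn=> x; rewrite negb_imply => /andP[xX /forallPn[y]].
rewrite negb_imply => /andP[yX /forallPn[S]].
rewrite negb_imply negbK => /andP[/andP[_ Sk] /and3P[xS yS nxy]].
have [xX' xp] := setDP xX; have [yX' yp] := setDP yX.
pose K := [set z | connect (delete e S) x z].
have dsym : connect_sym (delete e S).
  by apply: sym_connect_sym => a b; rewrite !deleteE e_sym [(a \notin S) && _]andbC.
have KS z : z \in K -> z \notin S.
  rewrite inE => /connectP[s ps ->]; elim: s x xS ps {nxy K xX xX' xp} => //= b s IH x xS.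
  by case/andP=> /and3P[_ _ bS]; exact: IH.
(* [K] is the component of [x] after deleting [S]. It is disjoint from [S], and the two sides meet
   inside [S]. *)
exists (S :|: K), (~: K); apply/and4P; split.
- apply/separationP => a b /predU1P[<-|eab].
    by rewrite in_setU in_setC; case: (a \in K); rewrite ?orbT.
  have Kab u z : e u z -> u \in K -> z \notin S -> z \in K.
    move=> euz uK zS; have uS := KS u uK.
    rewrite !inE in uK *; apply: connect_trans uK (connect1 _).
    by rewrite deleteE euz zS uS.
  have [aK|aK] := boolP (a \in K).
    rewrite !in_setU aK orbT; have [//|bS] := boolP (b \in S).
    by rewrite (Kab a b).
  have [bK|bK] := boolP (b \in K).
    rewrite !in_setU bK orbT andbT; have [//|aS] := boolP (a \in S).
    by rewrite e_sym in eab; rewrite (Kab b a) in aK.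
  by rewrite !in_setC aK bK orbT.
- apply: (card_root_side xX' xp xS Sk) => z xz; by rewrite !inE xz orbT.
- apply: (card_root_side yX' yp yS Sk) => z yz; rewrite !inE.
  by apply: contra nxy => xz; rewrite (connect_trans xz) // dsym.
- apply: leq_ltn_trans Sk; rewrite subset_leq_card //; apply/subsetP => z.
  by rewrite inE in_setC in_setU => /andP[/orP[//|->]].
Qed.

End FanCount.

(** The empty child is a starting [p] for [decomposition_leaf]: it contains no vertex of [X] and, as
    [0 < k], adds no weight. *)
Lemma decomposition_empty (T : finType) (e : rel T) k W (cs : seq (tree T)) :
  0 < k -> decomposition e k (Node W cs) ->
  decomposition e k (Node W (Node set0 [::] :: cs)).
Proof.
move=> k0 [wft cov]; split=> [|a b /cov]; last by case/orP=> /= ->; rewrite ?orbT.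
case/and3P: wft => all2 cnt2 adh2; apply/and3P; split.
- apply/andP; split=> //; apply/and3P; split=> //.
  by apply/forallP => x; apply/implyP.
- apply/forallP => x; have := forallP cnt2 x.
  rewrite -[count _ (_ :: _)]/((x \in set0) + count (fun c => x \in verts c) cs).
  by rewrite in_set0.
- by apply/andP; split=> //=; rewrite setI0 sub0set cards0 k0.
Qed.

(** Descent on the weight, from the single bag [setT], replaces the choice of a minimal
    decomposition: if the leaf part of [X] is not inseparable, splitting lowers the weight. *)
Lemma fan_set_inseparable (T : finType) (e : rel T) k m (X : {set T}) :
  symmetric e -> 0 < k -> k.*2 <= m.+1 -> X != set0 -> fan_set e m X ->
  exists Y, inseparable e k Y.
Proof.
move=> e_sym k0 km X0 fX.
suff H n W cs : weight k (Node W cs) < n -> decomposition e k (Node W cs) ->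
    exists Y, inseparable e k Y.
  apply: (H _ setT [::] (ltnSn _)); split=> [|a b _]; last by rewrite /= !inE.
  by apply/and3P; split=> //; apply/forallP => x; apply/implyP.
elim: n W cs => // n IH W cs le_n /(decomposition_empty k0) dec.
have X1 : X :\: verts (Node set0 [::]) != set0 by rewrite /= setD0.
have [W1 [p1 [cs1 [dec1 w1 {}X1 leaf1]]]] := decomposition_leaf dec X1.
have [ins|nins] := boolP (inseparable e k (X :\: verts p1)).
  by exists (X :\: verts p1).
have [C [D sCD]] := leaf_splits e_sym km fX dec1 leaf1 nins X1.
have [[V ds] dec2 w2] := decomposition_split e_sym dec1 sCD.
apply: (IH V ds) dec2; apply: leq_trans w2 _; rewrite w1 -ltnS.
by apply: leq_ltn_trans le_n; rewrite /= cards0 /bag_weight [k <= 0]leqNgt k0.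
Qed.

Theorem theorem1p3 (T : finType) (e : rel T)
    (e_sym : symmetric e) (e_irr : irreflexive e) :
  (adm_infty e + 1) %/ 2 <= beta e /\ beta e <= adm_infty e.
Proof.
split; last exact: leq_beta_adm.
set k := _ %/ 2; case: (posnP k) => [-> //|k0].
(* Rounding down gives exactly the bound that [fan_set_inseparable] asks for. *)
have km : k.*2 <= (adm_infty e).+1 by rewrite -addn1 -muln2 leq_trunc_div.
(* On the empty graph there is no nonempty [X], and the empty maximum 0 contradicts [k0]. *)
have [T0|T0] := posnP #|T|.
  suff a0 : adm_infty e = 0 by move: k0; rewrite /k a0.
  rewrite /adm_infty big_pred0 // => i; apply/existsP => -[X /andP[/set0Pn[x _] _]].
  by have := fintype0 x T0.
have [X X0 fX] := adm_attained e T0.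
have [Y insY] := fan_set_inseparable e_sym k0 km X0 fX.
have [Z bZ _] := maxset_exists insY.
exact: leq_beta bZ.
Qed.
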